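(* The code $\mathcal C_3(\mathbb D_d)$ has length $3^{2m}$, dimension $\frac{9m^2+7m}{2}+1$ over $\mathbb F_3$, and minimum Hamming distance at least $3^{2m-2}$.
   Context: Let $m\ge 2$ be an integer and $q=3^{2m}$. For $s\in\{m,2m\}$ let $\mathrm{Tr}_s:\mathbb F_{3^s}\to\mathbb F_3$ denote the absolute trace, $\mathrm{Tr}_s(x)=\sum_{i=0}^{s-1}x^{3^i}$. Vectors in $\mathbb F_3^{q}$ are indexed by the elements of $\mathbb F_{3^{2m}}$; a function $f:\mathbb F_{3^{2m}}\to\mathbb F_3$ is identified with the vector $(f(t))_{t\in\mathbb F_{3^{2m}}}$. Let $\mathcal C(2m,3)=\{c(a,b,h): a\in\mathbb F_{3^m}, b\in\mathbb F_{3^{2m}}, h\in\mathbb F_3\}$ where $c(a,b,h)=(\mathrm{Tr}_{2m}(at^{3^m+1}+bt)+h)_{t\in\mathbb F_{3^{2m}}}$. Let $d$ be the minimum Hamming weight of a nonzero codeword of $\mathcal C(2m,3)$ (it equals $2\cdot 3^{2m-1}-3^{m-1}$). Let $\mathbb D_d$ be the incidence structure with point set $\mathbb F_{3^{2m}}$ whose blocks are the supports $\{t: c_t\neq 0\}$ of the codewords $c\in\mathcal C(2m,3)$ of weight $d$. Let $\mathcal C_3(\mathbb D_d)$ be the $\mathbb F_3$-linear span in $\mathbb F_3^{\mathbb F_{3^{2m}}}$ of the incidence vectors of the blocks (the incidence vector of a block $B$ has entry $1$ at $t\in B$ and $0$ elsewhere). *)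

(* Defs.v *)
From HB Require Import structures.
From mathcomp Require Import all_boot all_order all_algebra all_field.
Set Implicit Arguments. Unset Strict Implicit. Unset Printing Implicit Defensive.
Import GRing.Theory.
Local Open Scope ring_scope.

Definition F3 := 'F_3.
Definition vecF3 (F : finFieldType) := {ffun F -> (F3^o)}.

Section Code.
Variables (m : nat) (F : finFieldType).

Definition Tr2m (x : F) : F := \sum_(i < 2 * m) x ^+ (3 ^ i).

(* the element of F_3 = 'F_3 whose image in F is y (0 if y is not in the
   prime field, which never happens for trace values) *)
Definition toF3 (y : F) : F3 := odflt 0 [pick c : F3 | (val c)%:R == y].

Definition inSub (a : F) : bool := a ^+ (3 ^ m) == a.

Definition cw (a b : F) (h : F3) : vecF3 F :=
  [ffun t : F => (toF3 (Tr2m (a * t ^+ (3 ^ m + 1) + b * t)) + h : F3^o)].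

Definition code : {set vecF3 F} :=
  [set cw ab.1.1 ab.1.2 ab.2 | ab in [set ab : F * F * F3 | inSub ab.1.1]].

Definition supp (c : vecF3 F) : {set F} := [set t | c t != 0].
Definition wt (c : vecF3 F) : nat := #|supp c|.

Definition dmin : nat := \big[minn/#|F|]_(c in code | c != 0) wt c.

Definition blocks : {set {set F}} :=
  [set supp c | c in [set c in code | (c != 0) && (wt c == dmin)]].

Definition incid (B : {set F}) : vecF3 F := [ffun t => ((t \in B)%:R : F3^o)].

Definition codeD : {vspace vecF3 F} := <<[seq incid B | B in blocks]>>%VS.

End Code.

(* Main.v *)
(* In characteristic 3 the incidence vector of the support of [c] is [c ^ 2]. After
   completing the square, the words [Tr (a N(t) + b t) + h] of minimum weight are the
   [Tr (a N(t - u)) + h] with [a] and [h] nonzero: surjectivity of the norm makes their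
   weight independent of [a] and [h], and [Tr (N t)] is zero at most as often as it is 1.
   Polarization shows that the squares of these words span all products of two words.
   Extending scalars to [F], the code of the design becomes the span of the monomials
   [t ^ e] where [e] is a sum of at most two terms [3 ^ i] or [3 ^ j (3 ^ m + 1)]; distinct
   base-3 expansions make these monomials independent, and counting them gives the
   dimension. All of them have degree at most 4 for iterated finite differences, and
   induction on this degree along the lines [t], [t + u], [t + u + u] gives the weight
   bound. *)
Require Import Defs.
From HB Require Import structures.
From mathcomp Require Import all_boot all_order all_algebra all_field.
From mathcomp Require Import cyclic zify ring.
Set Implicit Arguments. Unset Strict Implicit. Unset Printing Implicit Defensive.
Import GRing.Theory.
Local Open Scope ring_scope.

(** * Finite differences and weights *)

Section FiniteDifferences.
Variables (V : finZmodType) (R : comNzRingType).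
Implicit Types f g : V -> R.

Definition fdiff (u : V) f : V -> R := fun t => f (t + u) - f t.

(** Degree is measured by differences rather than by exponents, so that every additive map,
    Frobenius powers included, has degree at most 1. *)
Fixpoint deg_lt (n : nat) f : Prop :=
  if n is n'.+1 then forall u, deg_lt n' (fdiff u f) else forall t, f t = 0.

Lemma eq_deg_lt n f g : f =1 g -> deg_lt n f -> deg_lt n g.
Proof.
elim: n f g => [|n IHn] f g eq_fg /= df; first by move=> t; rewrite -eq_fg.
by move=> u; apply: IHn (df u) => t; rewrite /fdiff !eq_fg.
Qed.

Lemma deg_lt0 n : deg_lt n (fun=> 0).
Proof.
elim: n => [|n IHn] //= u.
by apply: eq_deg_lt IHn => t; rewrite /fdiff subr0.
Qed.

Lemma deg_ltD n f g : deg_lt n f -> deg_lt n g -> deg_lt n (fun t => f t + g t).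
Proof.
elim: n f g => [|n IHn] f g /= df dg; first by move=> t; rewrite df dg addr0.
move=> u; apply: eq_deg_lt (IHn _ _ (df u) (dg u)) => t.
by rewrite /fdiff opprD addrACA.
Qed.

Lemma deg_ltZ n c f : deg_lt n f -> deg_lt n (fun t => c * f t).
Proof.
elim: n f => [|n IHn] f /= df; first by move=> t; rewrite df mulr0.
by move=> u; apply: eq_deg_lt (IHn _ (df u)) => t; rewrite /fdiff mulrBr.
Qed.

Lemma deg_lt_sum n (I : Type) (r : seq I) (F : I -> V -> R) :
  (forall i, deg_lt n (F i)) -> deg_lt n (fun t => \sum_(i <- r) F i t).
Proof.
move=> dF; elim: r => [|i r IHr].
  by apply: eq_deg_lt (deg_lt0 n) => t; rewrite big_nil.
by apply: eq_deg_lt (deg_ltD (dF i) IHr) => t; rewrite big_cons.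
Qed.

Lemma deg_ltW n f : deg_lt n f -> deg_lt n.+1 f.
Proof.
elim: n f => [|n IHn] f /= df u; last exact: IHn (df u).
by move=> t; rewrite /fdiff !df subr0.
Qed.

Lemma leq_deg_lt m n f : (m <= n)%N -> deg_lt m f -> deg_lt n f.
Proof.
elim: n => [|n IHn]; first by case: m.
by rewrite leq_eqVlt => /orP[/eqP-> //|le_mn df]; apply/deg_ltW/IHn.
Qed.

Lemma deg_lt1_const f : deg_lt 1 f -> forall t, f t = f 0.
Proof.
by move=> df t; apply/eqP; rewrite -subr_eq0 -{1}(add0r t); apply/eqP/df.
Qed.

(** Double induction on the product rule: writing [d] for the difference,
    [d(f g) = df g + f dg + df dg], and each term falls under an induction hypothesis. *)
Lemma deg_ltM a b f g :
  deg_lt a.+1 f -> deg_lt b g -> deg_lt (a + b) (fun t => f t * g t).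
Proof.
elim: a b f g => [|a IHa] b f g df dg.
  by apply: eq_deg_lt (deg_ltZ (f 0) dg) => t; rewrite [in RHS]deg_lt1_const.
elim: b f g df dg => [|b IHb] f g df dg.
  by apply: eq_deg_lt (deg_lt0 _) => t; rewrite dg mulr0.
rewrite addSn /= => u.
have df_g := IHa _ _ _ (df u) dg.
have := IHb _ _ df (dg u); rewrite addSnnS => f_dg.
have df_dg := IHa _ _ _ (df u) (dg u).
have := deg_ltD (deg_ltD df_g f_dg) (leq_deg_lt _ df_dg).
rewrite leq_add2l => /(_ (leqnSn _)); apply: eq_deg_lt => t.
by rewrite /fdiff; ring.
Qed.

Lemma deg_lt_additive f : {morph f : x y / x + y} -> deg_lt 2 f.
Proof. by move=> fD u v t; rewrite /fdiff !fD; ring. Qed.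

Lemma deg_lt_prod (I : Type) (s : seq I) (F : I -> V -> R) :
  (forall i, {morph F i : x y / x + y}) ->
  deg_lt (size s).+1 (fun t => \prod_(i <- s) F i t).
Proof.
move=> FD; elim: s => [|i s IHs].
  by move=> u t; rewrite /fdiff !big_nil subrr.
apply: eq_deg_lt (deg_ltM (deg_lt_additive (FD i)) IHs) => t.
by rewrite big_cons.
Qed.

(** * Counting nonzero values along progressions *)

Definition nzcard f : nat := #|[set t | f t != 0]|.

Lemma nzcardE f : nzcard f = (\sum_t (f t != 0%R))%N.
Proof.
by rewrite /nzcard -sum1_card big_mkcond; apply: eq_bigr => t _; rewrite inE; case: eqP.
Qed.

(* Each point of [V] lies on three of the progressions [t, t + u, t + u + u]. *)
Lemma nzcard_triple f u :
  (3 * nzcard f = \sum_t ((f t != 0%R) + (f (t + u)%R != 0%R) + (f (t + u + u)%R != 0%R)))%N.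
Proof.
rewrite !big_split /= -nzcardE.
have shift g : (\sum_t (g (t + u)%R != 0%R) = nzcard g)%N.
  by rewrite nzcardE [RHS](reindex_inj (addIr u)).
have /= := shift (fun t => f (t + u)); rewrite [in RHS]nzcardE !shift => ->; lia.
Qed.

(** The second difference at [t] combines the values at [t], [t + u] and [t + u + u], so it vanishes
    where all three do. *)
Lemma nzcard_fdiff2 f u : (nzcard (fdiff u (fdiff u f)) <= 3 * nzcard f)%N.
Proof.
rewrite (nzcard_triple f u) nzcardE; apply: leq_sum => t _; rewrite /fdiff.
have [-> | _] := eqVneq (f t) 0; have [-> | _] := eqVneq (f (t + u)) 0;
  have [-> | _] := eqVneq (f (t + u + u)) 0; last by case: (_ != 0).
all: by rewrite ?subr0 ?eqxx //; case: (_ != 0).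
Qed.

Hypothesis double_inj : forall x : R, x *+ 2 = 0 -> x = 0.

(** The values at [t], [t + u], [t + u + u] form an arithmetic progression; if its step is nonzero,
    at most one of them is zero. *)
Lemma nzcard_fdiff1 f u : (forall t, fdiff u (fdiff u f) t = 0) ->
  (2 * nzcard (fdiff u f) <= 3 * nzcard f)%N.
Proof.
move=> ddf0; rewrite (nzcard_triple f u) nzcardE big_distrr /=.
apply: leq_sum => t _; rewrite /fdiff.
have -> : f (t + u + u) = f (t + u) *+ 2 - f t.
  by apply/eqP; rewrite -subr_eq0 -[X in _ == X](ddf0 t) /fdiff; apply/eqP; ring.
have [-> | nz_ft] := eqVneq (f t) 0; have [-> | nz_ftu] := eqVneq (f (t + u)) 0.
- by rewrite subr0 eqxx.
- rewrite !subr0 nz_ftu.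
  by have [/double_inj/eqP|//] := eqVneq (f (t + u) *+ 2) 0; rewrite (negPf nz_ftu).
- by rewrite mul0rn !sub0r !oppr_eq0 nz_ft.
- by case: (_ - _ != 0).
Qed.

(* The bound is [(3 - b) 3^(n - a - 1)] for degree [2 a + b] and [#|V| = 3^n], the
   minimum distance of the generalized Reed-Muller code. *)
Lemma nzcard_deg_lt a :
  (forall f, deg_lt (2 * a).+1 f -> (0 < nzcard f)%N -> (#|V| <= 3 ^ a * nzcard f)%N) /\
  (forall f, deg_lt (2 * a).+2 f -> (0 < nzcard f)%N ->
     (2 * #|V| <= 3 ^ a.+1 * nzcard f)%N).
Proof.
have const f : ~ (exists u, 0 < nzcard (fdiff u f))%N -> (0 < nzcard f)%N ->
    nzcard f = #|V|.
  move=> df0 /card_gt0P[t]; rewrite inE => nz_ft; apply/eqP.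
  rewrite /nzcard -cardsT; apply/eqP/eq_card => s; rewrite !inE.
  suff -> : f s = f t by [].
  apply/eqP; apply: contra_notT df0 => nz_fst; exists (s - t).
  by apply/card_gt0P; exists t; rewrite inE /fdiff [t + _]addrC subrK subr_eq0.
have zero f : nzcard f = 0%N -> forall t, f t = 0.
  move=> /eqP; rewrite cards_eq0 => /eqP f0 t; apply/eqP; apply/negPn.
  by have:= in_set0 t; rewrite -f0 inE => ->.
(* Three cases drive the induction: [f] is a nonzero constant, some second difference survives, or
   [f] is affine but not constant in some direction. *)
have split f : (0 < nzcard f)%N -> [\/ nzcard f = #|V|,
    exists2 u, (0 < nzcard (fdiff u (fdiff u f)))%N & True |
    exists2 u, (0 < nzcard (fdiff u f))%N & forall t, fdiff u (fdiff u f) t = 0].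
  move=> nz_f.
  have [/existsP[u du]|/existsPn d2] :=
    boolP [exists u, 0 < nzcard (fdiff u (fdiff u f))]%N.
    by constructor 2; exists u.
  have [/existsP[u du]|/existsPn d1] := boolP [exists u, 0 < nzcard (fdiff u f)]%N.
    by constructor 3; exists u => //; apply: zero; have := d2 u; lia.
  by constructor 1; apply: const => // -[u du]; have := d1 u; rewrite du.
elim: a => [|a [IHe IHo]].
  split=> f df nz_f; case: (split f nz_f) => [->|[u nz _]|[u nz ddf]].
  - by rewrite mul1n.
  - by move: nz => /card_gt0P[t]; rewrite inE {1}/fdiff !(df u) subrr eqxx.
  - by move: nz => /card_gt0P[t]; rewrite inE (df u) eqxx.
  - by rewrite expn1 leq_mul2r orbT.
  - by move: nz => /card_gt0P[t]; rewrite inE (df u u) eqxx.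
  - have := nzcard_fdiff1 ddf; rewrite expn1; apply: leq_trans; rewrite leq_mul2l /=.
    rewrite /nzcard -cardsT; apply/subset_leq_card/subsetP=> t _.
    move: nz => /card_gt0P[s]; rewrite !inE.
    by rewrite (deg_lt1_const (df u)) (deg_lt1_const (df u) t).
have p3 : (0 < 3 ^ a)%N by rewrite expn_gt0.
(* Two differences lower the degree by 2 at the cost of a factor 3; an affine direction lowers it by
   1 at the cost of 3/2. The odd bound at [a.+1] relies on this even one. *)
have IHe' f : deg_lt (2 * a.+1).+1 f -> (0 < nzcard f)%N ->
    (#|V| <= 3 ^ a.+1 * nzcard f)%N.
  move=> df nz_f; case: (split f nz_f) => [->|[u nz _]|[u nz ddf]].
  - by rewrite leq_pmull // expn_gt0.
  - move: df; rewrite mulnS => df; have := IHe _ (df u u) nz.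
    have := nzcard_fdiff2 f u; rewrite expnS; nia.
  - move: df; rewrite mulnS => df; have := IHo _ (df u) nz.
    have := nzcard_fdiff1 ddf; rewrite expnS; nia.
split=> // f df nz_f; case: (split f nz_f) => [->|[u nz _]|[u nz ddf]].
- by rewrite leq_mul2r !expnS; apply/orP; right; nia.
- move: df; rewrite mulnS => df; have := IHo _ (df u u) nz.
  have := nzcard_fdiff2 f u; rewrite !expnS; nia.
- have := IHe' _ (df u) nz; have := nzcard_fdiff1 ddf; rewrite !expnS; nia.
Qed.

End FiniteDifferences.

(** * Exponents in base 3 *)

Section BaseThree.

Lemma base3_digits_lt n (d : nat -> nat) :
  (forall k, d k <= 2)%N -> (\sum_(k < n) d k * 3 ^ k < 3 ^ n)%N.
Proof.
move=> d2; elim: n => [|n IHn]; first by rewrite big_ord0.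
rewrite big_ord_recr /= expnS; have := leq_mul (d2 n) (leqnn (3 ^ n)).
move: (\sum_(_ < n) _)%N (d n * 3 ^ n)%N (3 ^ n)%N IHn => x y z; lia.
Qed.

Lemma base3_digits_inj n (d e : nat -> nat) :
  (forall k, d k <= 2)%N -> (forall k, e k <= 2)%N ->
  (\sum_(k < n) d k * 3 ^ k = \sum_(k < n) e k * 3 ^ k)%N ->
  forall k, (k < n)%N -> d k = e k.
Proof.
move=> d2 e2; elim: n => [|n IHn] // eq_de.
have eq_n : d n = e n.
  move: eq_de; rewrite !big_ord_recr /=.
  have := base3_digits_lt n d2; have := base3_digits_lt n e2.
  move: (\sum_(_ < n) _)%N (\sum_(_ < n) _)%N (3 ^ n)%N (d n) (e n) => x y z a b; nia.
move=> k; rewrite ltnS leq_eqVlt => /orP[/eqP-> //|]; apply: IHn.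
by move: eq_de; rewrite !big_ord_recr /= eq_n => /addIn.
Qed.

Definition expo (s : seq nat) : nat := (\sum_(k <- s) 3 ^ k)%N.

Lemma expo_count n s : all (fun k => k < n)%N s ->
  expo s = (\sum_(k < n) count_mem (val k) s * 3 ^ k)%N.
Proof.
elim: s => [_|x s IHs /= /andP[xn /IHs]]; rewrite /expo.
  by rewrite big_nil big1.
rewrite big_cons => ->.
rewrite (bigD1 (Ordinal xn)) //= [in RHS](bigD1 (Ordinal xn)) //= eqxx mulnDl mul1n addnA.
congr (_ + _)%N; apply: eq_bigr => k nk; suff -> : (x == k) = false by [].
by apply: contraNF nk => /eqP xk; apply/eqP/val_inj.
Qed.

Lemma expo_lt n s : all (fun k => k < n)%N s -> (forall k, count_mem k s <= 2)%N ->
  (expo s < 3 ^ n)%N.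
Proof.
by move=> s_n s2; rewrite (expo_count s_n) (base3_digits_lt n (d := fun k => count_mem k s)).
Qed.

(** The multiplicities in [s] are the base-3 digits of [expo s]: being at most 2, they cause no
    carry. *)
Lemma expo_perm n s s' : all (fun k => k < n)%N s -> all (fun k => k < n)%N s' ->
  (forall k, count_mem k s <= 2)%N -> (forall k, count_mem k s' <= 2)%N ->
  expo s = expo s' -> perm_eq s s'.
Proof.
move=> sn sn' s2 s2'; rewrite (expo_count sn) (expo_count sn') => eq_ss'.
apply/allP => k /=; rewrite mem_cat => kss'; apply/eqP.
have kn : (k < n)%N by case/orP: kss'; [move/(allP sn)|move/(allP sn')].
exact: (base3_digits_inj (d := fun k => count_mem k s)
  (e := fun k => count_mem k s') s2 s2' eq_ss' kn).
Qed.

(** * The list of normal forms and its length *)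

Variable m : nat.

(* A list [s] of exponents stands for the monomial [\prod_(k <- s) t ^+ (3 ^ k)];
   these are the normal forms of the products of two factors taken among [1],
   [t ^+ (3 ^ i)] and [N(t) ^+ (3 ^ j)], where [N(t) = t ^+ (3 ^ m + 1)]. *)
Definition monos : seq (seq nat) :=
  [::] :: [seq [:: i] | i <- iota 0 (2 * m)]
  ++ [seq [:: i; j] | j <- iota 0 (2 * m), i <- iota 0 j.+1]
  ++ [seq [:: i; j; (j + m)%N] | i <- iota 0 (2 * m), j <- iota 0 m]
  ++ [seq [:: i; (i + m)%N; j; (j + m)%N] | j <- iota 0 m, i <- iota 0 j.+1].

Variant monos_spec : seq nat -> Prop :=
| Mono0 : monos_spec [::]
| Mono1 i : (i < 2 * m)%N -> monos_spec [:: i]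
| Mono2 i j : (i <= j < 2 * m)%N -> monos_spec [:: i; j]
| Mono3 i j : (i < 2 * m)%N -> (j < m)%N -> monos_spec [:: i; j; (j + m)%N]
| Mono4 i j : (i <= j < m)%N -> monos_spec [:: i; (i + m)%N; j; (j + m)%N].

Lemma monosP s : s \in monos <-> monos_spec s.
Proof.
rewrite /monos inE !mem_cat; split.
  case/orP=> [/eqP->|]; first exact: Mono0.
  case/or4P=> [/mapP[i]|/allpairsPdep[i [j []]]|/allpairsPdep[i [j []]]
    |/allpairsPdep[i [j []]]]; rewrite !mem_iota.
  - by move=> ? ->; apply: Mono1; lia.
  - by move=> ? ? ->; apply: Mono2; lia.
  - by move=> ? ? ->; apply: Mono3; lia.
  - by move=> ? ? ->; apply: Mono4; lia.
case=> [|i lei|i j lij|i j lei lej|i j lij]; rewrite ?eqxx //; apply/orP; right; apply/or4P.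
- by constructor 1; apply/mapP; exists i => //; rewrite mem_iota; lia.
- by constructor 2; apply/allpairsPdep; exists j, i; split=> //; rewrite mem_iota; lia.
- by constructor 3; apply/allpairsPdep; exists i, j; split=> //; rewrite mem_iota; lia.
- by constructor 4; apply/allpairsPdep; exists j, i; split=> //; rewrite mem_iota; lia.
Qed.

Lemma monos_size4 s : s \in monos -> (size s <= 4)%N.
Proof. by case/monosP. Qed.

Lemma monos_lt s : s \in monos -> all (fun k => k < 2 * m)%N s.
Proof. by case/monosP=> * /=; lia. Qed.

(** A norm factor contributes the distinct indices [j] and [j + m], so two factors never repeat an
    index three times. *)
Lemma monos_count s k : s \in monos -> (count_mem k s <= 2)%N.
Proof. by case/monosP=> * /=; lia. Qed.

(** The size separates the families; within one, the order [i <= j] or the bound [j < m] fixes the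
    indices, which are recovered from the sum and the members. *)
Lemma monos_perm s s' : s \in monos -> s' \in monos -> perm_eq s s' -> s = s'.
Proof.
move=> /monosP Ms /monosP Ms' eq_ss'.
have := perm_size eq_ss'; have := perm_sumn eq_ss'; have := perm_mem eq_ss'.
case: Ms {eq_ss'} => [|i ?|i j ?|i j ? ?|i j ?]; case: Ms' => [|i' ?|i' j' ?|i' j' ? ?|i' j' ?] //=.
- by move=> _ eq_i _; congr [:: _]; lia.
- move=> mem sum _; have := mem i; have := mem j; rewrite !inE !eqxx => *.
  by have [-> ->] : i = i' /\ j = j' by lia.
- move=> mem sum _; have := mem i; have := mem i'; have := mem j'; have := mem (j' + m)%N.
  rewrite !inE !eqxx => *.
  by have [-> ->] : i = i' /\ j = j' by lia.
- move=> mem sum _; have := mem i; have := mem j; have := mem i'; have := mem j'.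
  rewrite !inE !eqxx => *.
  by have [-> ->] : i = i' /\ j = j' by lia.
Qed.

Lemma monos_uniq : uniq monos.
Proof.
rewrite /monos cons_uniq !mem_cat !cat_uniq.
set r1 := map _ _; set r2 := flatten _; set r3 := flatten _; set r4 := flatten _.
have size1 : {in r1, forall s, size s = 1%N} by move=> s /mapP[i _ ->].
have size2 : {in r2, forall s, size s = 2%N} by move=> s /allpairsPdep[i [j [_ _ ->]]].
have size3 : {in r3, forall s, size s = 3%N} by move=> s /allpairsPdep[i [j [_ _ ->]]].
have size4 : {in r4, forall s, size s = 4%N} by move=> s /allpairsPdep[i [j [_ _ ->]]].
apply/and5P; split.
- rewrite !negb_or; apply/and4P.
  by split; apply/negP; [move/size1|move/size2|move/size3|move/size4].
- by rewrite map_inj_uniq ?iota_uniq // => i j [].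
- apply/hasPn=> s; rewrite !mem_cat => s234; apply/negP => /size1.
  by case/or3P: s234; [move/size2|move/size3|move/size4] => ->.
- rewrite /r2; apply: allpairs_uniq_dep => [|j _|]; rewrite ?iota_uniq //.
  by move=> [j i] [j' i'] _ _ /= [-> ->].
apply/and4P; split=> //.
- apply/hasPn=> s; rewrite !mem_cat => s34; apply/negP => /size2.
  by case/orP: s34; [move/size3|move/size4] => ->.
- apply: allpairs_uniq_dep => [|j _|]; rewrite ?iota_uniq //.
  by move=> [j i] [j' i'] _ _ /= [-> ->].
- by apply/hasPn=> s /size4 s4; apply/negP => /size3; rewrite s4.
- apply: allpairs_uniq_dep => [|j _|]; rewrite ?iota_uniq //.
  by move=> [j i] [j' i'] _ _ /= [-> _ ->].
Qed.

(** The five families have 1, [2 m], [m (2 m + 1)], [2 m ^ 2] and [m (m + 1) / 2] members. *)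
Lemma size_monos : size monos = ((9 * m ^ 2 + 7 * m) %/ 2 + 1)%N.
Proof.
have triangle n : (2 * sumn [seq size (iota 0 j.+1) | j <- iota 0 n] = n * n.+1)%N.
  elim: n => // n IHn; rewrite (_ : iota 0 n.+1 = iota 0 n ++ [:: n]); last by rewrite -addn1 iotaD.
  rewrite map_cat sumn_cat mulnDr IHn /=.
  by rewrite size_iota; lia.
rewrite /monos -cat1s !size_cat !size_allpairs_dep size_map size_iota [size [:: _]]/=.
rewrite (_ : sumn [seq size (iota 0 m) | _ <- iota 0 (2 * m)] = (2 * m * m)%N).
  have := triangle m; have := triangle (2 * m)%N.
  by move: (sumn _) (sumn _) => a b; rewrite -mulnn; lia.
by rewrite size_iota sumnE big_map big_const_seq count_predT size_iota iter_addn_0 mulnC.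
Qed.

Lemma expo_monos_uniq : uniq [seq expo s | s <- monos].
Proof.
rewrite map_inj_in_uniq ?monos_uniq // => s s' Ms Ms' eq_ss'; apply: monos_perm => //.
apply: expo_perm eq_ss'; try exact: monos_lt; by move=> k; apply: monos_count.
Qed.

End BaseThree.

(** * Trace functions over an extension of F_3 *)

(** A nonzero polynomial of degree below [#|F|] cannot have every element of [F] as a root. *)
Lemma finField_poly_fun_inj (F : finFieldType) (I : finType) (e : I -> nat) (c : I -> F) :
  injective e -> (forall i, (e i < #|F|)%N) ->
  (forall b : F, \sum_i c i * b ^+ e i = 0) -> forall i, c i = 0.
Proof.
move=> e_inj e_lt sum0 i; pose p := \sum_i c i *: 'X^(e i).
have coef_p j : p`_j = \sum_i c i * (j == e i)%:R.
  by rewrite coef_sum; apply: eq_bigr => k _; rewrite coefZ coefXn.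
have p0 : p = 0.
  apply/eqP; apply: contraT => nz_p.
  have root_p : all (root p) (enum F).
    apply/allP=> b _; apply/rootP; rewrite horner_sum -[RHS](sum0 b).
    by apply: eq_bigr => k _; rewrite hornerZ hornerXn.
  have := max_poly_roots nz_p root_p (enum_uniq F); rewrite -cardE ltnNge => /negP[].
  apply/leq_sizeP => j le_q; rewrite coef_p big1 // => k _.
  by rewrite gtn_eqF ?mulr0 // (leq_trans (e_lt k)).
have := coef_p (e i); rewrite p0 coef0 (bigD1 i) //= eqxx mulr1 big1 ?addr0 // => k ne_ki.
by rewrite (inj_eq e_inj) eq_sym (negPf ne_ki) mulr0.
Qed.

Section Field.
Variables (m : nat) (F : finFieldType).
Hypotheses (m_gt1 : (1 < m)%N) (cardF : #|F| = (3 ^ (2 * m))%N).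

Lemma pchar3 : 3 \in [pchar F].
Proof. exact: card_finPcharP cardF _. Qed.

Lemma natr3 : 3%:R = 0 :> F.
Proof. exact: pcharf0 pchar3. Qed.

Lemma double_eq0 (x : F) : x *+ 2 = 0 -> x = 0.
Proof.
move=> x2; rewrite (_ : x = x * 3%:R - x *+ 2); last by ring.
by rewrite natr3 mulr0 x2 subr0.
Qed.

Lemma frobD k : {morph (fun t : F => t ^+ (3 ^ k)) : x y / x + y}.
Proof.
move=> x y; apply: exprDn_pchar; rewrite pnatX; apply/orP; left.
by rewrite pnatE // pchar3.
Qed.

Lemma frob2m (x : F) : x ^+ (3 ^ (2 * m)) = x.
Proof. by rewrite -cardF expf_card. Qed.

Lemma frob_sum k (I : Type) (r : seq I) (P : pred I) (E : I -> F) :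
  (\sum_(i <- r | P i) E i) ^+ (3 ^ k) = \sum_(i <- r | P i) E i ^+ (3 ^ k).
Proof.
elim/big_rec2: _ => [|i x y _ <-]; last by rewrite frobD.
by rewrite expr0n; case: (3 ^ k)%N (expn_gt0 3 k).
Qed.

(** * The prime field inside [F] and the trace *)

Definition emb (c : F3) : F := (val c)%:R.

Lemma embM c d : emb (c * d) = emb c * emb d.
Proof.
rewrite /emb -natrM [in RHS](divn_eq (val c * val d) 3) natrD natrM natr3 mulr0 add0r.
by [].
Qed.

Lemma embD c d : emb (c + d) = emb c + emb d.
Proof.
rewrite /emb -natrD [in RHS](divn_eq (val c + val d) 3) natrD natrM natr3 mulr0 add0r.
by [].
Qed.

Lemma emb0 : emb 0 = 0. Proof. by []. Qed.
Lemma emb1 : emb 1 = 1. Proof. by []. Qed.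

Lemma emb_eq0 c : (emb c == 0) = (c == 0).
Proof.
rewrite /emb -(dvdn_pcharf pchar3).
by case: c => [[|[|[|k]]]].
Qed.

Lemma emb_cases c : [\/ emb c = 0, emb c = 1 | emb c = - 1].
Proof.
case: c => [[|[|[|k]]]] //= ck; [by constructor 1|by constructor 2|constructor 3].
by apply/eqP; rewrite -subr_eq0 opprK -(natrD _ 2 1) natr3.
Qed.

(** The roots of [y ^+ 3 - y] are 0, 1 and -1, all in the image of [emb], so the default value of
    [toF3] is not taken. *)
Lemma toF3K (y : F) : y ^+ 3 = y -> emb (toF3 y) = y.
Proof.
move=> y3; have: y * (y - 1) * (y + 1) = 0.
  by rewrite (_ : y * _ * _ = y ^+ 3 - y); [rewrite y3 subrr | ring].
move/eqP; rewrite !mulf_eq0 subr_eq0 addr_eq0 => y_cases.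
have [c cy] : exists c : F3, emb c = y.
  case/orP: y_cases => [/orP[/eqP->|/eqP->]|/eqP->]; [by exists 0|by exists 1|].
  exists (1 + 1); rewrite embD emb1; apply/eqP.
  by rewrite -subr_eq0 opprK -natr3; apply/eqP; ring.
rewrite /toF3; case: pickP => [d /eqP //|/(_ c)].
by rewrite -/(emb c) cy eqxx.
Qed.

Notation Tr := (@Tr2m m F).

Lemma TrD : {morph Tr : x y / x + y}.
Proof.
by move=> x y; rewrite /Tr2m -big_split; apply: eq_bigr => i _; rewrite frobD.
Qed.

Lemma Tr0 : Tr 0 = 0.
Proof. by apply: (addrI (Tr 0)); rewrite -TrD !addr0. Qed.

Lemma TrN : {morph Tr : x / - x}.
Proof. by move=> x; apply: (addrI (Tr x)); rewrite -TrD !subrr Tr0. Qed.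

Lemma Tr_frob x : Tr (x ^+ 3) = Tr x.
Proof.
have := frob2m x; rewrite /Tr2m; case: (2 * m)%N => [|n] xq; first by rewrite !big_ord0.
rewrite big_ord_recr big_ord_recl /= addrC; congr (_ + _).
  by rewrite -exprM -expnS xq expr1.
by apply: eq_bigr => i _; rewrite -exprM -expnS.
Qed.

Lemma Tr_frobn k x : Tr (x ^+ (3 ^ k)) = Tr x.
Proof. by elim: k => [|k IHk]; rewrite ?expr1 // expnSr exprM Tr_frob. Qed.

Lemma Tr_cube x : Tr x ^+ 3 = Tr x.
Proof.
rewrite -[RHS]Tr_frob [LHS](frob_sum 1); apply: eq_bigr => i _.
by rewrite -!exprM mulnC.
Qed.

Lemma emb_cube c : emb c ^+ 3 = emb c.
Proof. by case: (emb_cases c) => ->; ring. Qed.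

Lemma Tr_embM c x : Tr (x * emb c) = Tr x * emb c.
Proof.
rewrite /Tr2m big_distrl /=; apply: eq_bigr => i _; rewrite exprMn; congr (_ * _).
by elim: (val i) => [|k IHk]; rewrite ?expr1 // expnSr exprM IHk emb_cube.
Qed.

Lemma expn3_inj : injective (fun i : 'I_(2 * m) => 3 ^ i)%N.
Proof. by move=> i j /eqP; rewrite eqn_exp2l // => /eqP/val_inj. Qed.

Lemma frob_fun_inj (c : 'I_(2 * m) -> F) :
  (forall b, \sum_i c i * b ^+ (3 ^ i) = 0) -> forall i, c i = 0.
Proof.
apply: finField_poly_fun_inj; first exact: expn3_inj.
by move=> i; rewrite cardF ltn_exp2l.
Qed.

(** As a function of [b] the trace is a polynomial of degree below [#|F|] whose coefficient of [b]
    is [x]. *)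
Lemma Tr_nondegenerate x : (forall b, Tr (b * x) = 0) -> x = 0.
Proof.
move=> Tr0x; have lt0 : (0 < 2 * m)%N by lia.
rewrite -[x]expr1; apply: (frob_fun_inj (c := fun i => x ^+ (3 ^ i)) _ (Ordinal lt0)) => b.
by rewrite -[RHS](Tr0x b) /Tr2m; apply: eq_bigr => i _; rewrite exprMn mulrC.
Qed.

Notation VF := {ffun F -> F^o}.

(** Extension of scalars from F_3 to [F], where words decompose into monomials. *)
Definition lift (v : vecF3 F) : VF := [ffun t => emb (v t) : F^o].

(* The trace functionals [x -> Tr (b x)] turn a relation over [F] into relations over F_3. *)
Lemma lift_free (s : seq (vecF3 F)) : free s -> free [seq lift v | v <- s].
Proof.
rewrite -[s]/(tval (in_tuple s)) => /freeP s_free.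
rewrite -[map _ _]/(tval (map_tuple lift (in_tuple s))); apply/freeP => k sum0 i.
apply: Tr_nondegenerate => b.
have TrE j : emb (toF3 (Tr (b * k j))) = Tr (b * k j) by rewrite toF3K ?Tr_cube.
suff toF3_0 : forall j, toF3 (Tr (b * k j)) = 0 by rewrite -TrE toF3_0.
apply: s_free; apply/ffunP=> t; rewrite sum_ffunE ffunE.
apply/eqP; rewrite -emb_eq0; apply/eqP.
have -> (E : 'I_(size s) -> F3) : emb (\sum_j E j) = \sum_j emb (E j).
  by apply: (big_morph _ embD emb0).
have /ffunP/(_ t) := sum0; rewrite sum_ffunE [RHS]ffunE => sum0t.
have: Tr (b * 0) = 0 by rewrite mulr0 Tr0.
rewrite -{1}sum0t big_distrr /= (big_morph _ TrD Tr0) => sum0Tr; rewrite -[RHS]sum0Tr.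
apply: eq_bigr => j _; rewrite !ffunE embM TrE -Tr_embM.
by rewrite (nth_map 0) // ?ffunE -mulrA.
Qed.

Lemma lift_span_sub (X : seq (vecF3 F)) (W : {vspace VF}) :
  (forall v, v \in X -> lift v \in W) -> forall v, v \in <<X>>%VS -> lift v \in W.
Proof.
move=> XW v; rewrite -[X]/(tval (in_tuple X)) => /coord_span ->.
set k := fun _ => _.
have -> : lift (\sum_(i < size X) coord (in_tuple X) i v *: X`_i)
    = \sum_(i < size X) emb (coord (in_tuple X) i v) *: lift X`_i.
  apply/ffunP=> t; rewrite ffunE !sum_ffunE (big_morph _ embD emb0).
  by apply: eq_bigr => i _; rewrite !ffunE embM.
by apply: memv_suml => i _; apply/memvZ/XW/mem_nth.
Qed.

(* Modulo [W] the coordinates of the sum are polynomials in [b] of degree below [#|F|]. *)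
Lemma frob_comb_mem (W : {vspace VF}) (w : nat -> VF) :
  (forall b : F, \sum_(i < 2 * m) b ^+ (3 ^ i) *: w i \in W) ->
  forall i, (i < 2 * m)%N -> w i \in W.
Proof.
(* A vector lies in [W] exactly when it equals its projection to [W]. *)
move=> sumW i lti; have: w i - projv W (w i) = 0.
  apply/ffunP=> t; rewrite [RHS]ffunE.
  pose c (j : 'I_(2 * m)) := (w j - projv W (w j)) t.
  apply: (frob_fun_inj (c := c) _ (Ordinal lti)) => b.
  have := projv_id (sumW b); rewrite linear_sum => /eqP.
  rewrite eq_sym -subr_eq0 -sumrB => /eqP/ffunP/(_ t); rewrite sum_ffunE [RHS]ffunE => {2}<-.
  apply: eq_bigr => j _; rewrite linearZ /= -scalerBr /c [RHS]ffunE mulrC.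
  by [].
by move/eqP; rewrite subr_eq0 => /eqP->; apply: memv_proj.
Qed.

Definition mono (s : seq nat) : VF := [ffun t => \prod_(k <- s) t ^+ (3 ^ k) : F^o].

Lemma monoE s t : mono s t = t ^+ expo s.
Proof.
rewrite ffunE /expo; elim: s => [|k s IHs]; first by rewrite !big_nil.
by rewrite !big_cons IHs exprD.
Qed.

Lemma mono_free : free [seq mono s | s <- monos m].
Proof.
set L := monos m.
rewrite -[map _ _]/(tval (map_tuple mono (in_tuple L))); apply/freeP => k sum0.
apply: (@finField_poly_fun_inj F _ (fun i : 'I_(size L) => expo (nth [::] L i))).
- move=> i j eq_ij; apply/ord_inj/eqP.
  rewrite -(nth_uniq 0%N (s := [seq expo s | s <- L])) ?size_map ?expo_monos_uniq //.
  by rewrite !(nth_map [::]) //; apply/eqP.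
- move=> i; rewrite cardF; apply: expo_lt; first exact/monos_lt/mem_nth.
  by move=> ?; apply/monos_count/mem_nth.
move=> b; have /ffunP/(_ b) := sum0; rewrite sum_ffunE [RHS]ffunE => {2}<-.
by apply: eq_bigr => i _; rewrite ffunE (nth_map [::]) // monoE.
Qed.

(** * The design code consists of combinations of monomials *)

(** The norm from [F] to the subfield cut out by [inSub]; [conj3] is the involution fixing that
    subfield. *)
Definition Nm (t : F) : F := t ^+ (3 ^ m + 1).
Definition conj3 (t : F) : F := t ^+ (3 ^ m).

Lemma conj3K : involutive conj3.
Proof. by move=> t; rewrite /conj3 -exprM -expnD addnn -mul2n frob2m. Qed.

Lemma conj3D : {morph conj3 : x y / x + y}. Proof. exact: frobD. Qed.

Lemma conj3M : {morph conj3 : x y / x * y}. Proof. by move=> x y; apply: exprMn. Qed.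

Lemma NmE t : Nm t = t * conj3 t.
Proof. by rewrite /Nm addn1 exprS. Qed.

Lemma NmM : {morph Nm : x y / x * y}.
Proof. by move=> x y; apply: exprMn. Qed.

Lemma Nm_frob k t : Nm t ^+ (3 ^ k) = t ^+ (3 ^ k) * t ^+ (3 ^ (k + m)).
Proof. by rewrite NmE exprMn /conj3 -exprM -expnD addnC. Qed.

Lemma emb_cw a b h t : emb (cw m a b h t) = Tr (a * Nm t + b * t) + emb h.
Proof. by rewrite ffunE embD toF3K ?Tr_cube. Qed.

Lemma lift_incid c t : lift (incid (supp c)) t = emb (c t) ^+ 2.
Proof.
rewrite !ffunE inE -emb_eq0.
by case: (emb_cases (c t)) => ->; rewrite ?oppr_eq0 ?oner_eq0 ?eqxx ?sqrrN ?expr1n ?expr0n.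
Qed.

(** The monomials occurring in one word. The pairs follow the [2 * m] terms of the trace, so each
    power of the norm appears twice. *)
Definition gens : seq (seq nat) :=
  [::] :: [seq [:: i] | i <- iota 0 (2 * m)] ++ [seq [:: i; (i + m)%N] | i <- iota 0 (2 * m)].

Lemma mono_cat s s' t : mono (s ++ s') t = mono s t * mono s' t.
Proof. by rewrite !ffunE big_cat. Qed.

Lemma eq_mono_perm s s' : perm_eq s s' -> mono s = mono s'.
Proof. by move=> eq_ss'; apply/ffunP=> t; rewrite !ffunE (perm_big _ eq_ss'). Qed.

(** For [i >= m] the index [i + m] wraps around to [i - m], because [t ^+ (3 ^ (2 * m)) = t]. *)
Lemma mono_gensE g : g \in gens -> exists2 g', mono g = mono g' &
  [\/ g' = [::], exists2 i, (i < 2 * m)%N & g' = [:: i] |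
      exists2 i, (i < m)%N & g' = [:: i; (i + m)%N] ].
Proof.
rewrite inE mem_cat => /orP[/eqP->|/orP[]/mapP[i]]; first by exists [::]; [|constructor 1].
  by rewrite mem_iota => lti ->; exists [:: i]; [|constructor 2; exists i].
rewrite mem_iota => lti ->; have [lt_im|le_mi] := ltnP i m.
  by exists [:: i; (i + m)%N]; [|constructor 3; exists i].
exists [:: (i - m)%N; (i - m + m)%N]; last by constructor 3; exists (i - m)%N => //; lia.
apply/ffunP=> t; rewrite !ffunE !big_cons subnK // mulrCA; congr (_ * (_ * _)).
have -> : (i + m = 2 * m + (i - m))%N by lia.
by rewrite expnD exprM frob2m.
Qed.

Lemma mono_gensM g1 g2 : g1 \in gens -> g2 \in gens ->
  mono (g1 ++ g2) \in <<[seq mono s | s <- monos m]>>%VS.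
Proof.
have mem_mono s s' : perm_eq s s' -> monos_spec m s' ->
    mono s \in <<[seq mono s | s <- monos m]>>%VS.
  move=> eq_ss' /monosP Ms'; rewrite (eq_mono_perm eq_ss').
  exact/memv_span/map_f.
move=> /mono_gensE[g1' E1 G1] /mono_gensE[g2' E2 G2].
have -> : mono (g1 ++ g2) = mono (g1' ++ g2').
  by apply/ffunP=> t; rewrite !mono_cat E1 E2.
case: G1 G2 => [->|[i lti ->]|[i lti ->]] [->|[j ltj ->]|[j ltj ->]] /=.
- by apply: mem_mono (perm_refl _) _; constructor.
- by apply: mem_mono (perm_refl _) _; constructor.
- by apply: mem_mono (perm_refl _) _; constructor; lia.
- by apply: mem_mono (perm_refl _) _; constructor.
- have [le_ij|lt_ji] := leqP i j; first by apply: mem_mono (perm_refl _) _; constructor; lia.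
  by apply: (mem_mono _ [:: j; i]); [rewrite (perm_catC [:: i] [:: j])|constructor; lia].
- by apply: mem_mono (perm_refl _) _; constructor.
- by apply: mem_mono (perm_refl _) _; constructor; lia.
- apply: (mem_mono _ [:: j; i; (i + m)%N]); last by constructor.
  by rewrite (perm_catC [:: i; (i + m)%N] [:: j]).
- have [le_ij|lt_ji] := leqP i j; first by apply: mem_mono (perm_refl _) _; constructor; lia.
  apply: (mem_mono _ [:: j; (j + m)%N; i; (i + m)%N]); last by constructor; lia.
  by rewrite (perm_catC [:: i; (i + m)%N] [:: j; (j + m)%N]).
Qed.

Lemma Tr_lin b t : Tr (b * t) = \sum_(i < 2 * m) b ^+ (3 ^ i) * mono [:: val i] t.
Proof.
by apply: eq_bigr => i _; rewrite ffunE big_cons big_nil mulr1 exprMn.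
Qed.

Lemma Tr_Nm a t : Tr (a * Nm t) = \sum_(i < 2 * m) a ^+ (3 ^ i) * mono [:: val i; (val i + m)%N] t.
Proof.
by apply: eq_bigr => i _; rewrite ffunE !big_cons big_nil mulr1 exprMn Nm_frob.
Qed.

Lemma emb_cw_mono a b h t : emb (cw m a b h t) =
  \sum_(g <- gens) (if g is i :: g' then (if g' is [::] then b else a) ^+ (3 ^ i) else emb h)
     * mono g t.
Proof.
have iota_sum (E : nat -> F) : \sum_(i <- iota 0 (2 * m)) E i = \sum_(i < 2 * m) E i.
  by rewrite -(big_mkord xpredT E) /index_iota subn0.
rewrite emb_cw TrD Tr_Nm Tr_lin big_cons big_cat /= !big_map ffunE big_nil mulr1 !iota_sum.
by rewrite [RHS]addrC; congr (_ + _); apply: addrC.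
Qed.

Lemma lift_codeD v : v \in codeD m F -> lift v \in <<[seq mono s | s <- monos m]>>%VS.
Proof.
apply: lift_span_sub => {}v /mapP[B + ->]; rewrite mem_enum => /imsetP[c].
rewrite inE => /andP[/imsetP[[[a b] h] /= _ -> _] ->].
pose k g := if g is i :: g' then (if g' is [::] then b else a) ^+ (3 ^ i) else emb h.
have -> : lift (incid (supp (cw m a b h))) =
    \sum_(g1 <- gens) \sum_(g2 <- gens) (k g1 * k g2) *: mono (g1 ++ g2).
  apply/ffunP=> t; rewrite lift_incid emb_cw_mono expr2 big_distrl sum_ffunE.
  apply: eq_bigr => g1 _; rewrite big_distrr sum_ffunE; apply: eq_bigr => g2 _.
  by rewrite [RHS]ffunE mono_cat; apply: mulrACA.
rewrite !big_seq; apply: memv_suml => g1 G1; rewrite big_seq.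
by apply: memv_suml => g2 G2; apply/memvZ/mono_gensM.
Qed.

Lemma deg_span_monos (w : VF) :
  w \in <<[seq mono s | s <- monos m]>>%VS -> deg_lt 5 (fun t => w t : F).
Proof.
rewrite -[map _ _]/(tval (map_tuple mono (in_tuple (monos m)))) => /coord_span->.
set X := map_tuple _ _; set k := coord X.
apply: (@eq_deg_lt _ _ _ (fun t => \sum_(i < size (monos m)) k i w * (X`_i) t)).
  by move=> t; rewrite sum_ffunE; apply: eq_bigr => i _; rewrite ffunE.
apply: deg_lt_sum => i; apply: deg_ltZ.
rewrite (nth_map [::]) //; set s := nth _ _ _.
have Ms : s \in monos m by apply: mem_nth.
apply: (@eq_deg_lt _ _ _ (fun t => \prod_(j <- s) t ^+ (3 ^ j))).
  by move=> t; rewrite ffunE.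
apply: (@leq_deg_lt _ _ (size s).+1); first by rewrite ltnS (monos_size4 Ms).
by apply: (@deg_lt_prod F F _ s (fun j t => t ^+ (3 ^ j))) => j; apply: frobD.
Qed.

Lemma wt_nzcard (v : vecF3 F) : wt v = nzcard (fun t => emb (v t)).
Proof. by apply: eq_card => t; rewrite !inE emb_eq0. Qed.

Lemma wt_codeD v : v \in codeD m F -> v != 0 -> (3 ^ (2 * m - 2) <= wt v)%N.
Proof.
move=> /lift_codeD/deg_span_monos dv nz_v; rewrite wt_nzcard.
have {}dv : deg_lt 5 (fun t => emb (v t)).
  by apply: eq_deg_lt dv => t; rewrite ffunE.
have nz : (0 < nzcard (fun t => emb (v t)))%N.
  rewrite -wt_nzcard card_gt0; apply: contraNneq nz_v => v0; apply/eqP/ffunP=> t.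
  by have := in_set0 t; rewrite -v0 inE ffunE => /negPn/eqP.
(* Degree at most 4 is the even case [a = 2], whence [#|F| <= 3 ^ 2 * wt v]. *)
have [+ _] := nzcard_deg_lt F double_eq0 2 => /(_ _ dv nz); rewrite cardF.
have -> : (2 * m = 2 + (2 * m - 2))%N by lia.
by rewrite expnD leq_pmul2l // addKn.
Qed.

(** * Minimum weight words *)

Implicit Types a b t u x : F.

Lemma inSubE a : inSub m a = (conj3 a == a). Proof. by []. Qed.

Lemma Nm_inSub t : inSub m (Nm t).
Proof. by rewrite inSubE NmE conj3M conj3K mulrC. Qed.

Lemma inSubD a b : inSub m a -> inSub m b -> inSub m (a + b).
Proof. by rewrite !inSubE conj3D => /eqP-> /eqP->. Qed.

Lemma inSubM a b : inSub m a -> inSub m b -> inSub m (a * b).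
Proof. by rewrite !inSubE conj3M => /eqP-> /eqP->. Qed.

Lemma conj3N : {morph conj3 : x / - x}.
Proof.
move=> x; apply: (addIr (conj3 x)); rewrite -conj3D !addNr /conj3 expr0n.
by rewrite expn_eq0.
Qed.

Lemma inSubN a : inSub m a -> inSub m (- a).
Proof. by rewrite !inSubE conj3N => /eqP->. Qed.

Lemma inSubV a : inSub m a -> inSub m a^-1.
Proof. by rewrite !inSubE /conj3 exprVn => /eqP->. Qed.

Lemma inSub1 : inSub m (1 : F).
Proof. by rewrite inSubE /conj3 expr1n. Qed.

Lemma Nm0 : Nm 0 = 0. Proof. by rewrite NmE mul0r. Qed.
Lemma Nm1 : Nm 1 = 1. Proof. exact: expr1n. Qed.

Lemma Nm_eq0 t : (Nm t == 0) = (t == 0).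
Proof. by rewrite expf_eq0 addn1. Qed.

(** Write [a = z ^+ k] with [z] a primitive root. Then [a ^+ (3 ^ m - 1) = 1] forces [3 ^ m + 1] to
    divide [k]. *)
Lemma Nm_surj a : inSub m a -> exists s, Nm s = a.
Proof.
have [-> _|nz_a aK] := eqVneq a 0; first by exists 0; rewrite Nm0.
pose rs := [seq x <- enum F | x != 0].
have q_gt1 : (1 < #|F|)%N by rewrite cardF -{1}(expn0 3) ltn_exp2l; lia.
have q1 : (0 < #|F|.-1)%N by lia.
have unity x : x != 0 -> x ^+ #|F|.-1 = 1.
  by move=> nz_x; apply: (mulfI nz_x); rewrite -exprS mulr1 prednK ?expf_card //; lia.
have: has #|F|.-1.-primitive_root rs.
  have uniq_rs : uniq rs by rewrite filter_uniq ?enum_uniq.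
  apply: has_prim_root => //.
    by apply/allP=> x; rewrite mem_filter => /andP[nz_x _]; apply/unity_rootP/unity.
  rewrite -(card_uniqP uniq_rs) -(cardC1 (0 : F)).
  by apply/subset_leq_card/subsetP=> x; rewrite mem_filter mem_enum andbT.
case/hasP=> z _ prim_z.
have [[k _] /= ak] := prim_rootP prim_z (unity _ nz_a).
have q1E : (#|F|.-1 = (3 ^ m + 1) * (3 ^ m - 1))%N.
  by rewrite cardF mul2n -addnn expnD; have := expn_gt0 3 m; nia.
have p3 : (1 < 3 ^ m)%N by rewrite -{1}(expn0 3) ltn_exp2l; lia.
have: (#|F|.-1 %| k * (3 ^ m - 1))%N.
  rewrite (prim_order_dvd prim_z) exprM -ak.
  apply/eqP/(mulfI nz_a); rewrite -exprS mulr1; have -> : (3 ^ m - 1).+1 = (3 ^ m)%N by lia.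
  by apply/eqP; move: aK; rewrite inSubE.
rewrite q1E dvdn_pmul2r ?subn_gt0 // => /dvdnP[l kE].
by exists (z ^+ l); rewrite /Nm -exprM -kE.
Qed.

Lemma Tr_conj3 a : Tr (conj3 a) = Tr a. Proof. exact: Tr_frobn. Qed.

(** If [Tr b] is nonzero, [b + conj3 b] is in the subfield and has trace [2 Tr b = - Tr b]; a sign
    change then suffices. *)
Lemma exists_trace1 : exists2 a, inSub m a & Tr a = 1.
Proof.
have [b nz_b] : exists b, Tr b != 0.
  apply/existsP; apply: contraT => /existsPn Tr0b.
  suff /eqP : (1 : F) = 0 by rewrite oner_eq0.
  by apply: Tr_nondegenerate => b; apply/eqP/negPn.
have cK : inSub m (b + conj3 b) by rewrite inSubE conj3D conj3K addrC.
have Trc : Tr (b + conj3 b) = - Tr b.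
  rewrite TrD Tr_conj3; apply/eqP; rewrite -subr_eq0 opprK; apply/eqP.
  by rewrite -[RHS](mulr0 (Tr b)) -natr3; ring.
have := emb_cases (toF3 (Tr b)); rewrite toF3K ?Tr_cube // => -[/eqP|Tr1|TrN1].
- by rewrite (negPf nz_b).
- by exists (- (b + conj3 b)); [apply: inSubN|rewrite TrN Trc opprK Tr1].
- by exists (b + conj3 b); rewrite ?Trc ?TrN1 ?opprK.
Qed.

(** The two cross terms of [Nm (t - u)] are conjugate, so they have equal traces, and [-2 = 1]. *)
Lemma Tr_Nm_shift a u t : inSub m a ->
  Tr (a * Nm (t - u)) = Tr (a * Nm t) + Tr (a * conj3 u * t) + Tr (a * Nm u).
Proof.
move=> aK.
have -> : a * Nm (t - u) = a * Nm t + a * Nm u - (a * conj3 u * t + conj3 (a * conj3 u * t)).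
  rewrite !conj3M conj3K (eqP (_ : conj3 a == a)) // !NmE.
  by rewrite conj3D conj3N; ring.
rewrite !TrD TrN TrD Tr_conj3.
set x := Tr (_ * conj3 u * t).
rewrite (_ : - (x + x) = x - x * 3%:R); last by ring.
by rewrite natr3; ring.
Qed.

Lemma nzcard_bij (f g : F -> F) (h : F -> F) : injective h -> (forall t, f (h t) = g t) ->
  nzcard f = nzcard g.
Proof.
move=> h_inj fg; rewrite !nzcardE (reindex_inj h_inj).
by apply: eq_bigr => t _; rewrite fg.
Qed.

Definition norm_wt a h : nat := nzcard (fun t => Tr (a * Nm t) + h).

Lemma norm_wtN a h : norm_wt (- a) (- h) = norm_wt a h.
Proof.
by apply: eq_card => t; rewrite !inE mulNr TrN -opprD oppr_eq0.
Qed.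

Lemma norm_wt_scale a h : inSub m a -> a != 0 -> norm_wt a h = norm_wt 1 h.
Proof.
move=> /Nm_surj[s <-]; rewrite Nm_eq0 => nz_s; apply/esym.
by apply: (nzcard_bij (mulfI nz_s)) => t; rewrite mul1r NmM.
Qed.

(** Here [h] is 1 or -1; the sign moves into [a], which a substitution [t -> s t] with [Nm s = a]
    removes. *)
Lemma norm_wt_cube a h : inSub m a -> a != 0 -> h ^+ 3 = h -> h != 0 ->
  norm_wt a h = norm_wt 1 1.
Proof.
move=> aK nz_a h3 nz_h; rewrite norm_wt_scale //.
case: (emb_cases (toF3 h)); rewrite toF3K // => hE; first by rewrite hE eqxx in nz_h.
  by rewrite hE.
rewrite -norm_wtN hE opprK norm_wt_scale ?inSubN ?inSub1 //.
by rewrite oppr_eq0 oner_eq0.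
Qed.

Lemma card_trace_values (f : F -> F) : (forall t, f t ^+ 3 = f t) ->
  #|F| = (#|[set t | f t == 0%R]| + #|[set t | f t == 1%R]| + #|[set t | f t == (-1)%R]|)%N.
Proof.
move=> f3; have n1 : (1 : F) != 0 by apply: oner_neq0.
have nN1 : (-1 : F) != 0 by rewrite oppr_eq0.
have n1N : (1 : F) != -1.
  by rewrite -subr_eq0 opprK; apply: contraNneq n1 => /double_eq0 ->.
rewrite -!sum1_card !(big_mkcond (fun t => t \in _)) -!big_split /=.
apply: eq_bigr => t _; rewrite !inE; case: (emb_cases (toF3 (f t))); rewrite toF3K // => ->.
- by rewrite eqxx ![0 == _]eq_sym (negPf n1) (negPf nN1).
- by rewrite eqxx (negPf n1) (negPf n1N).
- by rewrite eqxx (negPf nN1) [- 1 == 1]eq_sym (negPf n1N).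
Qed.

(* Given [x] in the subfield with trace 1, a nonzero [t] with [Tr (Nm t) = 0] is moved
   inside its line to a point of norm [Nm t + x]; the point 0 goes to a point of norm [x]. *)
Lemma leq_norm_trace_zeros :
  (#|[set t | Tr (Nm t) == 0%R]| <= #|[set t | Tr (Nm t) == 1%R]|)%N.
Proof.
have [x xK Trx] := exists_trace1.
have root_ex a : exists s, inSub m a ==> (Nm s == a).
  by have [/Nm_surj[s <-]|_] := boolP (inSub m a); [exists s; rewrite eqxx|exists 0].
pose rt a := xchoose (root_ex a).
have rtE a : inSub m a -> Nm (rt a) = a by move=> aK; apply/eqP/(implyP (xchooseP (root_ex a))).
pose f t := if t == 0 then rt x else t * rt ((Nm t + x) / Nm t).
have Nf t : Nm (f t) = Nm t + x.
  rewrite /f; have [->|nz_t] := eqVneq t 0; first by rewrite rtE // Nm0 add0r.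
  rewrite NmM rtE; first by rewrite mulrC divfK // Nm_eq0.
  by rewrite inSubM ?inSubV ?inSubD ?Nm_inSub.
rewrite -(card_in_imset (f := f)).
  apply/subset_leq_card/subsetP=> _ /imsetP[t + ->]; rewrite !inE => /eqP Trt.
  by rewrite Nf TrD Trt Trx add0r.
move=> t s; rewrite !inE => /eqP Trt /eqP Trs eq_f.
have eqN : Nm t = Nm s by apply: (addIr x); rewrite -!Nf eq_f.
move: eq_f; rewrite /f -!(Nm_eq0 t) -(Nm_eq0 s) -eqN.
have [Nt0 _|nz_Nt] := eqVneq (Nm t) 0.
  have /eqP-> : t == 0 by rewrite -Nm_eq0 Nt0.
  by apply/esym/eqP; rewrite -Nm_eq0 -eqN Nt0.
apply: mulIf; rewrite -Nm_eq0 rtE; last by rewrite inSubM ?inSubV ?inSubD ?Nm_inSub.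
rewrite mulf_neq0 ?invr_neq0 //; apply/eqP => Ntx0.
by have := oner_neq0 F; rewrite -Trx -[x](addKr (Nm t)) Ntx0 addr0 TrN Trt oppr0 eqxx.
Qed.

(** [z] counts the [t] with [Tr (Nm t)] equal to 0 and 1 respectively; the value -1 is taken as
    often as 1, by scaling [t] with an element of norm -1. *)
Lemma norm_wt_values : exists2 z : nat * nat, (z.1 <= z.2)%N &
  [/\ #|F| = (z.1 + 2 * z.2)%N, norm_wt 1 0 = (2 * z.2)%N & norm_wt 1 1 = (z.1 + z.2)%N].
Proof.
exists (#|[set t | Tr (Nm t) == 0]|, #|[set t | Tr (Nm t) == 1]|).
  exact: leq_norm_trace_zeros.
have eqN : #|[set t | Tr (Nm t) == -1]| = #|[set t | Tr (Nm t) == 1]|.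
  have [s sN1] := Nm_surj (inSubN inSub1).
  have nz_s : s != 0 by rewrite -Nm_eq0 sN1 oppr_eq0 oner_eq0.
  rewrite -(card_preimset _ (mulfI nz_s)); apply: eq_card => t.
  by rewrite !inE NmM sN1 mulN1r TrN eqr_oppLR opprK.
have q3 := card_trace_values (fun t => Tr_cube (Nm t)).
have wtE h : norm_wt 1 h = (#|F| - #|[set t | Tr (Nm t) == - h]|)%N.
  rewrite /norm_wt /nzcard cardsCs; congr (_ - _)%N; apply: eq_card => t.
  by rewrite !inE negbK mul1r addr_eq0.
move: q3; rewrite !wtE oppr0 eqN => ->.
move: #|_| #|_| => z p; split=> /=; lia.
Qed.

Lemma wt_cw_norm a b h : inSub m a -> a != 0 ->
  exists2 h', h' ^+ 3 = h' & wt (cw m a b h) = norm_wt a h'.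
Proof.
(* Completing the square: this [u] gives [a * conj3 u = b], so shifting by [u] absorbs the linear
   term. *)
move=> aK nz_a; pose u := conj3 (b / a).
pose c := toF3 (Tr (a * Nm u)).
exists (emb (h - c)); first exact: emb_cube.
rewrite wt_nzcard; apply/esym.
apply: (nzcard_bij (addIr (- u))) => t.
rewrite emb_cw Tr_Nm_shift // TrD conj3K [a * (b / a)]mulrC divfK // -addrA.
have <- : emb c = Tr (a * Nm u) by rewrite toF3K ?Tr_cube.
by rewrite -embD [c + _]addrC subrK.
Qed.

Lemma wt_cw_ge a b h : inSub m a -> cw m a b h != 0 -> (norm_wt 1%R 1%R <= wt (cw m a b h))%N.
Proof.
move=> aK nz_c; have [[z p] /= le_zp [q3 wt0 wt1]] := norm_wt_values.
have [a0|nz_a] := eqVneq a 0; last first.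
  have [h' h'3 ->] := wt_cw_norm b h aK nz_a.
  have [->|nz_h'] := eqVneq h' 0; last by rewrite norm_wt_cube.
  by rewrite norm_wt_scale // wt0 wt1; lia.
have d2 : deg_lt 2 (fun t => emb (cw m a b h t)).
  apply: (@eq_deg_lt _ _ _ (fun t => Tr (b * t) + emb h)).
    by move=> t; rewrite emb_cw a0 mul0r add0r.
  apply: deg_ltD; last by move=> u v t; rewrite /fdiff !subrr.
  by apply: deg_lt_additive => x y; rewrite mulrDr TrD.
have nz : (0 < nzcard (fun t => emb (cw m a b h t)))%N.
  rewrite -wt_nzcard card_gt0; apply: contraNneq nz_c => c0; apply/eqP/ffunP=> t.
  by have := in_set0 t; rewrite -c0 inE => /negPn/eqP ->; rewrite ffunE.
(* For [a = 0] the word is affine and the bound reads [2 #|F| <= 3 wt], enough since [z <= p]. *)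
have [_ /(_ _ d2 nz)] := nzcard_deg_lt F double_eq0 0.
by rewrite -wt_nzcard wt1 q3 expn1; lia.
Qed.

Lemma dminE : dmin m F = norm_wt 1 1.
Proof.
have c_code : cw m (1 : F) 0 1 \in code m F.
  by apply/imsetP; exists (1, 0, 1); rewrite ?inE ?inSub1.
have wt_c : wt (cw m (1 : F) 0 1) = norm_wt 1 1.
  by rewrite wt_nzcard; apply: eq_card => t; rewrite !inE emb_cw mul0r addr0 emb1.
have nz_c : cw m (1 : F) 0 1 != 0.
  apply/eqP => /ffunP/(_ 0)/(congr1 emb).
  by rewrite emb_cw Nm0 !mulr0 addr0 Tr0 add0r ffunE => /eqP; rewrite oner_eq0.
apply/eqP; rewrite eqn_leq; apply/andP; split.
  rewrite -wt_c /dmin; have: cw m (1 : F) 0 1 \in index_enum _ by rewrite mem_index_enum.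
  elim: (index_enum _) => //= c r IHr; rewrite inE big_cons => /orP[/eqP<-|/IHr le_r].
    by rewrite c_code nz_c geq_minl.
  by case: ifP => // _; rewrite geq_min le_r orbT.
(* The starting value [#|F|] of the minimum must be bounded below as well. *)
rewrite /dmin; elim/big_ind: _ => [|x y|c /andP[]].
- exact: max_card.
- by rewrite leq_min => -> ->.
case/imsetP=> [[[a b] h]]; rewrite inE /= => aK -> nz_wc; exact: wt_cw_ge aK nz_wc.
Qed.

(** * Every monomial is obtained *)

Section Products.
Variable W : {vspace VF}.

Definition inW (f : F -> F) : Prop := ([ffun t => f t : F^o] : VF) \in W.

Lemma mem_inW (v : VF) f : (forall t, v t = f t) -> v \in W -> inW f.
Proof.
by move=> vf Wv; rewrite /inW (_ : finfun _ = v) //; apply/ffunP=> t; rewrite ffunE -vf.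
Qed.

Lemma inW_mem (v : VF) f : (forall t, f t = v t) -> inW f -> v \in W.
Proof.
by move=> fv; rewrite /inW (_ : finfun _ = v) //; apply/ffunP=> t; rewrite ffunE fv.
Qed.

Lemma eq_inW f g : f =1 g -> inW f -> inW g.
Proof. by move=> eq_fg; apply: mem_inW => t; rewrite ffunE. Qed.

Lemma inWD f g : inW f -> inW g -> inW (fun t => f t + g t).
Proof. by move=> Wf Wg; apply: mem_inW (memvD Wf Wg) => t; rewrite !ffunE. Qed.

Lemma inWZ c f : inW f -> inW (fun t => c * f t).
Proof. by move=> Wf; apply: mem_inW (memvZ c Wf) => t; rewrite !ffunE. Qed.

Lemma inWB f g : inW f -> inW g -> inW (fun t => f t - g t).
Proof.
move=> Wf Wg; apply: eq_inW (inWD Wf (inWZ (-1) Wg)) => t.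
by rewrite mulN1r.
Qed.

Hypothesis W_blocks : forall a u h, inSub m a -> a != 0 -> h != 0 ->
  inW (fun t => (Tr (a * Nm (t - u)) + emb h) ^+ 2).

Notation Q a t := (Tr (a * Nm t)).
Notation l b t := (Tr (b * t)).

(** Reduces an identity modulo 3 to one that [ring] proves, with [z] the explicit quotient. *)
Let eq_mod3 (x y z : F) : x = y + 3%:R * z -> x = y.
Proof. by rewrite natr3 mul0r addr0. Qed.

Let inW_plus1 a u : inSub m a -> a != 0 -> inW (fun t => (Q a (t - u) + 1) ^+ 2).
Proof. by move=> aK nz_a; apply: (W_blocks u aK nz_a (oner_neq0 F3)). Qed.

Let inW_minus1 a u : inSub m a -> a != 0 -> inW (fun t => (Q a (t - u) - 1) ^+ 2).
Proof.
move=> aK nz_a; have := @W_blocks a u (1 + 1) aK nz_a isT; apply: eq_inW => t.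
rewrite embD emb1; apply: (eq_mod3 (z := 2%:R * Q a (t - u) + 1)); ring.
Qed.

(** [(Q + 1)^2 - (Q - 1)^2 = 4 Q = Q]. *)
Let inW_Qshift a u : inSub m a -> a != 0 -> inW (fun t => Q a (t - u)).
Proof.
move=> aK nz_a; apply: eq_inW (inWB (inW_plus1 u aK nz_a) (inW_minus1 u aK nz_a)) => t.
apply: (eq_mod3 (z := Q a (t - u))); ring.
Qed.

Let inW_Q2shift a u : inSub m a -> a != 0 -> inW (fun t => Q a (t - u) ^+ 2 + 1).
Proof.
move=> aK nz_a.
apply: eq_inW (inWZ (-1) (inWD (inW_plus1 u aK nz_a) (inW_minus1 u aK nz_a))) => t.
apply: (eq_mod3 (z := - (Q a (t - u) ^+ 2 + 1))); ring.
Qed.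

Let inW_Q a : inSub m a -> inW (fun t => Q a t).
Proof.
move=> aK; have [->|nz_a] := eqVneq a 0.
  by apply: eq_inW (inWZ 0 (inW_Qshift 0 inSub1 (oner_neq0 F))) => t; rewrite !mul0r Tr0.
by apply: eq_inW (inW_Qshift 0 aK nz_a) => t; rewrite subr0.
Qed.

(** The second difference of [Q x] in direction 1 is the constant [2 Tr x], nonzero when
    [Tr x = 1]. *)
Let inW_1 : inW (fun=> 1).
Proof.
have [x xK Trx] := exists_trace1.
have nz_x : x != 0 by apply: contra_eqN Trx => /eqP->; rewrite Tr0 eq_sym oner_neq0.
have sum2 := inWD (inW_Qshift 1 xK nz_x) (inW_Qshift (-1) xK nz_x).
apply: eq_inW (inWB (inW_Q xK) (inWD sum2 (inWZ (-1) (inW_Q xK)))) => t.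
rewrite !Tr_Nm_shift // conj3N mulrN mulNr TrN.
have -> : Nm (-1) = Nm 1 by rewrite !NmE conj3N mulrNN.
rewrite Nm1 mulr1 Trx; apply: (eq_mod3 (z := -1)); ring.
Qed.

Let inW_l b : inW (fun t => l b t).
Proof.
have := inW_Qshift (conj3 b) inSub1 (oner_neq0 F) => Ws.
have := inWB (inWB Ws (inW_Q inSub1)) (inWZ (Tr (1 * Nm (conj3 b))) inW_1).
apply: eq_inW => t; rewrite Tr_Nm_shift ?inSub1 // conj3K !mul1r; ring.
Qed.

Let inW_sq a b : inSub m a -> inW (fun t => (Q a t + l b t) ^+ 2).
Proof.
have sq_nz c d : inSub m c -> c != 0 -> inW (fun t => (Q c t + l d t) ^+ 2).
  move=> cK nz_c; pose u := conj3 (d / c); pose k := Tr (c * Nm u).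
  have W2 := inWB (inW_Q2shift u cK nz_c) inW_1.
  (* With [S = Q + l + k] the shifted form, [(Q + l)^2 = S^2 - 2 k S + k^2]. *)
  have := inWD (inWB W2 (inWZ (2%:R * k) (inW_Qshift u cK nz_c))) (inWZ (k ^+ 2) inW_1).
  apply: eq_inW => t; rewrite Tr_Nm_shift // conj3K [c * (d / c)]mulrC divfK // -/k; ring.
have [->|] := eqVneq a 0; last by move=> nz_a aK; apply: sq_nz.
(* For [a = 0]: [Q^2 + (Q + l)^2 + (Q - l)^2 = 3 Q^2 + 2 l^2 = - l^2]. *)
move=> _; have Ql2 c := sq_nz 1 c inSub1 (oner_neq0 F).
apply: eq_inW (inWZ (-1) (inWD (Ql2 0) (inWD (Ql2 b) (Ql2 (- b))))) => t.
rewrite !mul0r Tr0 [- b * t]mulNr TrN; apply: (eq_mod3 (z := - (Q 1 t ^+ 2 + l b t ^+ 2))); ring.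
Qed.

Definition word a b h t := Q a t + l b t + h.

(** Lets [a] range over all of [F], as [frob_comb_mem] demands: replacing [a] by [-(a + conj3 a)]
    multiplies the trace by [-2 = 1]. *)
Let word_sub a b h : exists2 a', inSub m a' & forall t, word a b h t = word a' b h t.
Proof.
exists (- (a + conj3 a)); first by rewrite inSubN // inSubE conj3D conj3K addrC.
move=> t; congr (_ + _ + _); rewrite mulNr TrN mulrDl TrD.
have -> : conj3 a * Nm t = conj3 (a * Nm t).
  by rewrite conj3M (eqP (_ : conj3 (Nm t) == Nm t)) // -inSubE Nm_inSub.
rewrite Tr_conj3; apply: (eq_mod3 (z := Q a t)); ring.
Qed.

(** Polarization: [f g = -((f + g)^2 - f^2 - g^2)] since [2 = -1]. *)
Lemma inW_word_mul a b h a' b' h' : inW (fun t => word a b h t * word a' b' h' t).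
Proof.
have [c cK cE] := word_sub a b h; have [c' cK' cE'] := word_sub a' b' h'.
have Wf := inWD (inW_Q cK) (inW_l b); have Wg := inWD (inW_Q cK') (inW_l b').
have W2 := inWB (inWB (inW_sq (b + b') (inSubD cK cK')) (inW_sq b cK)) (inW_sq b' cK').
have := inWD (inWD (inWZ (-1) W2) (inWD (inWZ h' Wf) (inWZ h Wg))) (inWZ (h * h') inW_1).
apply: eq_inW => t; rewrite cE cE' /word !mulrDl !TrD.
apply: (eq_mod3 (z := - ((Q c t + l b t) * (Q c' t + l b' t)))); ring.
Qed.

(** Varying [a] or [b] separates the Frobenius powers in the second factor; two applications
    separate both factors. *)
Let gens_inW (f : F -> F) : (forall a b h, inW (fun t => f t * word a b h t)) ->
  forall g, g \in gens -> inW (fun t => f t * mono g t).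
Proof.
move=> Wf g; rewrite inE mem_cat => /orP[/eqP->|/orP[]/mapP[i]].
- apply: eq_inW (Wf 0 0 1) => t.
  by rewrite /word !mul0r Tr0 !add0r ffunE big_nil.
- rewrite mem_iota => lti ->; rewrite /inW.
  apply: (frob_comb_mem (w := fun i => [ffun t => f t * mono [:: i] t : F^o])) => // b.
  apply: inW_mem (Wf 0 b 0) => t.
  rewrite sum_ffunE /word mul0r Tr0 add0r addr0 Tr_lin big_distrr /=.
  by apply: eq_bigr => j _; rewrite [RHS]ffunE [X in _ = _ *: X]ffunE; apply: mulrCA.
- rewrite mem_iota => lti ->; rewrite /inW.
  apply: (frob_comb_mem (w := fun i => [ffun t => f t * mono [:: i; (i + m)%N] t : F^o])) => // a.
  apply: inW_mem (Wf a 0 0) => t.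
  rewrite sum_ffunE /word mul0r Tr0 !addr0 Tr_Nm big_distrr /=.
  by apply: eq_bigr => j _; rewrite [RHS]ffunE [X in _ = _ *: X]ffunE; apply: mulrCA.
Qed.

Lemma monos_inW s : s \in monos m -> mono s \in W.
Proof.
have cat_inW g1 g2 : g1 \in gens -> g2 \in gens -> mono (g1 ++ g2) \in W.
  move=> G1 G2; have : inW (fun t => mono g1 t * mono g2 t).
    apply: gens_inW G2 => a b h; apply: (@eq_inW (fun t => word a b h t * mono g1 t)).
      by move=> t; rewrite mulrC.
    by apply: gens_inW G1 => a' b' h'; apply: inW_word_mul.
  by apply: inW_mem => t; rewrite mono_cat.
have G0 : [::] \in gens by rewrite inE eqxx.
have G1 i : (i < 2 * m)%N -> [:: i] \in gens.
  move=> lti; rewrite inE mem_cat; apply/orP; right; apply/orP; left.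
  by apply/mapP; exists i; rewrite // mem_iota.
have G2 i : (i < m)%N -> [:: i; (i + m)%N] \in gens.
  move=> lti; rewrite inE mem_cat; apply/orP; right; apply/orP; right.
  by apply/mapP; exists i; rewrite // mem_iota; lia.
case/monosP=> [|i lti|i j lij|i j lti ltj|i j lij].
- exact: (cat_inW [::] [::]).
- exact: (cat_inW [::] [:: i] G0 (G1 i _)).
- by apply: (cat_inW [:: i] [:: j]); apply: G1; lia.
- by apply: (cat_inW [:: i] [:: j; (j + m)%N]); [apply: G1|apply: G2].
- by apply: (cat_inW [:: i; (i + m)%N] [:: j; (j + m)%N]); apply: G2; lia.
Qed.

End Products.

(** * The dimension of the design code *)

Lemma block_in_codeD a u h : inSub m a -> a != 0 -> h != 0 ->
  exists2 v, v \in codeD m F & forall t, lift v t = (Tr (a * Nm (t - u)) + emb h) ^+ 2.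
Proof.
move=> aK nz_a nz_h.
pose c := cw m a (a * conj3 u) (h + toF3 (Tr (a * Nm u))).
have cE t : emb (c t) = Tr (a * Nm (t - u)) + emb h.
  rewrite emb_cw Tr_Nm_shift // TrD embD toF3K ?Tr_cube //; ring.
exists (incid (supp c)); last by move=> t; rewrite lift_incid cE.
apply/memv_span/map_f; rewrite mem_enum; apply: imset_f.
have wt_c : wt c = norm_wt 1 1.
  rewrite -(norm_wt_cube aK nz_a (emb_cube h)) ?emb_eq0 // wt_nzcard.
  by apply/esym/(nzcard_bij (addIr (- u))) => t; rewrite cE.
rewrite inE dminE wt_c eqxx andbT; apply/andP; split.
  by apply/imsetP; exists (a, a * conj3 u, h + toF3 (Tr (a * Nm u))); rewrite ?inE.
(* At [t = u] the word takes the value [h], so it is nonzero. *)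
apply: contraNneq nz_h => c0; rewrite -emb_eq0; have := cE u.
by rewrite c0 ffunE subrr Nm0 mulr0 Tr0 add0r => <-.
Qed.

(** A basis over F_3 stays free over [F] after [lift], and its span [W] coincides with the span of
    the independent monomials. *)
Lemma dim_codeD : \dim (codeD m F) = size (monos m).
Proof.
pose s := vbasis (codeD m F); pose W := <<[seq lift v | v <- s]>>%VS.
have spanW v : v \in codeD m F -> lift v \in W.
  rewrite -{1}(span_basis (vbasisP (codeD m F))); apply: lift_span_sub => {}v sv.
  exact/memv_span/map_f.
have free_s : free s := basis_free (vbasisP _).
have <- : \dim W = \dim (codeD m F).
  by have /eqP-> := lift_free free_s; rewrite size_map size_tuple.
have -> : W = <<[seq mono s | s <- monos m]>>%VS.
  apply: subv_anti; apply/andP; split; apply/span_subvP=> _ /mapP[v sv ->].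
    exact/lift_codeD/(vbasis_mem sv).
  apply: monos_inW sv => a u h aK nz_a nz_h.
  have [w /spanW Ww wE] := block_in_codeD u aK nz_a nz_h.
  exact: mem_inW wE Ww.
by have /eqP-> := mono_free; rewrite size_map.
Qed.

End Field.

Theorem theorem3p16 (m : nat) (F : finFieldType) :
  (2 <= m)%N -> #|F| = (3 ^ (2 * m))%N ->
  [/\ #|F| = (3 ^ (2 * m))%N,
      \dim (codeD m F) = ((9 * m ^ 2 + 7 * m) %/ 2 + 1)%N &
      forall v : vecF3 F, v \in codeD m F -> v != 0 ->
        (3 ^ (2 * m - 2) <= wt v)%N].
Proof.
move=> m_gt1 cardF; split=> //; first by rewrite (dim_codeD m_gt1 cardF) size_monos.
by move=> v; apply: wt_codeD.
Qed.
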